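(* Let $(A,\mathfrak m)$ be a Cohen-Macaulay local ring of dimension $d$ and let $I$ be a proper ideal of $A$. Let $M$ be a nonzero finitely generated $A$-module. Set $m=\mu(I)$ and $g=\operatorname{grade}(I,M)$. Then (1) if $\operatorname{projdim}_A M\le d-g-1$ then $\operatorname{depth}H_{m-g}(I,M)\ge1$; (2) if $\operatorname{projdim}_A M\le d-g-2$ then $\operatorname{depth}H_{m-g}(I,M)\ge2$.
   Context: $\mu(I)$ is the minimal number of generators of $I$; $\operatorname{grade}(I,M)$ is the length of a maximal $M$-regular sequence in $I$. $H_i(I,M)$ is the $i$-th Koszul homology module with coefficients in $M$ of a minimal generating set of $I$ (independent, up to isomorphism, of the choice). *)

(* Defs.v *)
From HB Require Import structures.
From mathcomp Require Import all_boot all_order all_algebra.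
From mathcomp Require Import boolp.

Set Implicit Arguments.
Unset Strict Implicit.
Unset Printing Implicit Defensive.

Import GRing.Theory.
Local Open Scope ring_scope.
Local Open Scope quotient_scope.

(* Throughout, [idealr A] is the library's type of proper ideals of A.  Its
   underlying predicates are boolean, which is no restriction under the
   classical axioms of boolp. *)

Section Ideals.
Variable A : comNzRingType.

Definition generates (s : seq A) (I : idealr A) : Prop :=
  forall y, y \in I <-> exists c : 'I_(size s) -> A, y = \sum_(i < size s) c i * s`_i.

(* The unit ideal is generated by 1, so proper ideals suffice. *)
Definition noetherian : Prop := forall J : idealr A, exists s, generates s J.

Definition maximal_ideal (P : idealr A) : Prop :=
  forall J : idealr A, {subset P <= J} -> {subset J <= P}.

Definition local_ring (mA : idealr A) : Prop :=
  maximal_ideal mA /\ forall P : idealr A, maximal_ideal P -> P =i mA.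

Definition prime_chain (n : nat) (P : nat -> prime_idealr A) : Prop :=
  forall i, (i < n)%N -> {subset P i <= P i.+1} /\ ~ {subset P i.+1 <= P i}.

Definition krull_dim (d : nat) : Prop :=
  (exists P, prime_chain d P) /\
  forall n P, prime_chain n P -> (n <= d)%N.

(* [min_num_gens I m] states mu(I) = m. *)
Definition min_num_gens (I : idealr A) (m : nat) : Prop :=
  (exists2 s, generates s I & size s = m) /\
  forall s, generates s I -> (m <= size s)%N.

End Ideals.

Section Modules.
Variables (A : comNzRingType) (M : lmodType A).

Definition finitely_generated : Prop :=
  exists (n : nat) (e : 'I_n -> M),
    forall v, exists c : 'I_n -> A, v = \sum_i c i *: e i.

(* [in_smul s v] states v \in (s_0, ..., s_(k-1)) M. *)
Definition in_smul (s : seq A) (v : M) : Prop :=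
  exists c : 'I_(size s) -> M, v = \sum_(i < size s) s`_i *: c i.

(* s_k is a nonzerodivisor on M / (s_0, ..., s_(k-1)) M for each k, and
   M <> (s) M. *)
Definition regular_seq (s : seq A) : Prop :=
  (forall k, (k < size s)%N ->
     forall v, in_smul (take k s) (s`_k *: v) -> in_smul (take k s) v) /\
  exists v, ~ in_smul s v.

Definition maximal_regular_seq (I : idealr A) (s : seq A) : Prop :=
  [/\ {subset s <= I}, regular_seq s
    & forall y, y \in I -> ~ regular_seq (rcons s y)].

(* [grade I g] states that g is the length of a maximal M-regular sequence
   in I; for M finitely generated over a noetherian ring with M <> I M, such
   sequences exist and all have the same length. *)
Definition grade (I : idealr A) (g : nat) : Prop :=
  exists2 s, maximal_regular_seq I s & size s = g.

Definition projective : Prop :=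
  forall (N L : lmodType A) (f : {linear N -> L}) (h : {linear M -> L}),
    (forall y, exists x, f x = y) ->
    exists h' : {linear M -> N}, forall x, f (h' x) = h x.

End Modules.

Arguments grade {A} M I g.
Arguments regular_seq {A} M s.
Arguments finitely_generated {A} M.
Arguments projective {A} M.

(* Depth over the local ring with maximal ideal mA.  With this definition
   the zero module has no depth. *)
Definition depth (A : comNzRingType) (mA : idealr A) (M : lmodType A) :
  nat -> Prop := grade M mA.

Section ProjDim.
Variables (A : comNzRingType) (M : lmodType A).

(* 0 -> P n -> ... -> P 0 -> M -> 0 exact, with projective terms. *)
Definition proj_resolution (n : nat) (P : nat -> lmodType A)
    (d : forall i, {linear P i.+1 -> P i}) (e : {linear P 0%N -> M}) : Prop :=
  [/\ (forall i, projective (P i)),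
      (forall i, (n < i)%N -> forall x : P i, x = 0),
      (forall y, exists x, e x = y),
      (forall x, e x = 0 <-> exists y, d 0%N y = x)
    & (forall i x, d i x = 0 <-> exists y, d i.+1 y = x)].

Definition has_proj_resolution (n : nat) : Prop :=
  exists P d e, @proj_resolution n P d e.

Definition projdim (n : nat) : Prop :=
  has_proj_resolution n /\ forall k, has_proj_resolution k -> (n <= k)%N.

End ProjDim.

Definition cohen_macaulay_local (A : comNzRingType) (mA : idealr A) : Prop :=
  [/\ noetherian A, local_ring mA
    & exists2 d, krull_dim A d & depth mA (A^o : lmodType A) d].

(* The A-module structure on the library's quotient of additive groups. *)
Section QuotientModule.
Variables (A : comNzRingType) (V : lmodType A) (W : zmodClosed V).
Hypothesis W_scale : forall a v, v \in W -> a *: v \in W.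
Local Notation Q := {ideal_quot W}.

Definition quot_scale (a : A) (q : Q) : Q := \pi_Q (a *: repr q).

Fact pi_quot_scale a v : quot_scale a (\pi_Q v) = \pi_Q (a *: v).
Proof.
apply/eqP; rewrite -Quotient.idealrBE -scalerBr W_scale //.
by rewrite Quotient.idealrBE reprK.
Qed.

Fact quot_scaleA a b q : quot_scale a (quot_scale b q) = quot_scale (a * b) q.
Proof. by elim/quotW: q => v; rewrite (pi_quot_scale b) !pi_quot_scale scalerA. Qed.

Fact quot_scale1 : left_id 1 quot_scale.
Proof. by elim/quotW => v; rewrite pi_quot_scale scale1r. Qed.

Fact quot_scaleDr : right_distributive quot_scale +%R.
Proof.
move=> a; elim/quotW => u; elim/quotW => v.
by rewrite -raddfD (pi_quot_scale a (u + v)) (pi_quot_scale a u) (pi_quot_scale a v) -raddfD scalerDr.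
Qed.

Fact quot_scaleDl q : {morph quot_scale^~ q : a b / a + b}.
Proof.
by elim/quotW: q => v a b; rewrite !pi_quot_scale -raddfD -scalerDl.
Qed.

End QuotientModule.

Section Koszul.
Variables (A : comNzRingType) (M : lmodType A) (x : seq A).
Local Notation n := (size x).

(* The Koszul complex \Lambda(A^n) \otimes M: the element f stands for
   \sum_S e_S \otimes f S, and has degree i when f S = 0 for all S with
   #|S| != i. *)
Definition koszul : Type := {ffun {set 'I_n} -> M}.
HB.instance Definition _ := GRing.Lmodule.on koszul.

Definition koszul_degree (i : nat) (f : koszul) : bool :=
  [forall S : {set 'I_n}, (#|S| != i) ==> (f S == 0)].

(* d (e_S \otimes v) =
     \sum_(j in S) (-1)^#{k in S | k < j} e_(S \ j) \otimes x_j v,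
   read off at the coefficient of e_T, where S = T + j. *)
Definition koszul_diff (f : koszul) : koszul :=
  [ffun T : {set 'I_n} => \sum_(j : 'I_n | j \notin T)
     (-1) ^+ #|[set k in T | (k < j)%N]| *: (x`_j *: f (j |: T))].

Fact koszul_diff_linear : linear koszul_diff.
Proof.
move=> a f g; apply/ffunP => T; rewrite !ffunE scaler_sumr -big_split /=.
apply: eq_bigr => j _; rewrite !ffunE /= !scalerDr; congr (_ + _).
by rewrite !scalerA; congr (_ *: _); rewrite mulrC !mulrA.
Qed.
HB.instance Definition _ :=
  GRing.isLinear.Build A koszul koszul _ koszul_diff koszul_diff_linear.

Lemma koszul_degreeP i (f : koszul) :
  reflect (forall S : {set 'I_n}, #|S| <> i -> f S = 0) (koszul_degree i f).
Proof.
apply: (iffP forallP) => [h S /eqP Si | h S].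
  by apply/eqP; move/implyP: (h S); apply.
by apply/implyP => /eqP Si; rewrite h.
Qed.

Lemma koszul_degree_lin i a f g :
  koszul_degree i f -> koszul_degree i g -> koszul_degree i (a *: f + g).
Proof.
move=> /koszul_degreeP hf /koszul_degreeP hg; apply/koszul_degreeP => S Si.
by rewrite !ffunE hf // hg // scaler0 addr0.
Qed.

Lemma koszul_diff_degree i f :
  koszul_degree i.+1 f -> koszul_degree i (koszul_diff f).
Proof.
move=> /koszul_degreeP hf; apply/koszul_degreeP => T Ti; rewrite ffunE.
apply: big1 => j jT; rewrite hf ?scaler0 // cardsU1 jT => -[]; exact: Ti.
Qed.

Lemma koszul_diff_diff f : koszul_diff (koszul_diff f) = 0.
Proof.
apply/ffunP => T; rewrite !ffunE.
pose G (j k : 'I_n) : M := 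
   (-1) ^+ #|[set l in T | (l < j)%N]| *: (x`_j *:
    ((-1) ^+ #|[set l in j |: T | (l < k)%N]| *: (x`_k *: f (k |: (j |: T))))).
transitivity (\sum_(p : 'I_n * 'I_n |
    [&& p.1 \notin T, p.2 \notin T & p.1 != p.2]) G p.1 p.2).
  rewrite [RHS](eq_bigl (fun p : 'I_n * 'I_n =>
     (p.1 \notin T) && (p.2 \notin p.1 |: T))); last first.
    by move=> [j k] /=; rewrite in_setU1 negb_or eq_sym [X in _ && X]andbC.
  rewrite -(pair_big_dep (fun j => j \notin T) (fun j k => k \notin j |: T) G).
  apply: eq_bigr => j _; rewrite ffunE scaler_sumr scaler_sumr.
  by apply: eq_bigr.
rewrite (bigID (fun p : 'I_n * 'I_n => (p.1 < p.2)%N)) /=.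
rewrite [X in _ + X](reindex_inj (h := fun p : 'I_n * 'I_n => (p.2, p.1))) /=;
  last by move=> [? ?] [? ?] /= [-> ->].
rewrite [X in _ + X](eq_bigl (fun p : 'I_n * 'I_n =>
   [&& p.1 \notin T, p.2 \notin T & p.1 != p.2] && (p.1 < p.2)%N)); last first.
  move=> [j k] /=; rewrite -(inj_eq val_inj k j) -(inj_eq val_inj j k) /= -leqNgt.
  by case: (ltngtP j k); rewrite ?andbF ?andbT /= 1?andbC.
rewrite -big_split /= big1 // => -[j k] /= /andP[/and3P[jT kT jk] ltjk].
have E1 : #|[set l in j |: T | (l < k)%N]| = #|[set l in T | (l < k)%N]|.+1.
  rewrite (_ : [set l in j |: T | _] = j |: [set l in T | (l < k)%N]).
    by rewrite cardsU1 inE (negbTE jT).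
  by apply/setP => l; rewrite !inE; case: (eqVneq l j) => [->|].
have E2 : #|[set l in k |: T | (l < j)%N]| = #|[set l in T | (l < j)%N]|.
  apply: eq_card => l; rewrite !inE; case: (eqVneq l k) => [->|//] /=.
  by rewrite ltnNge (ltnW ltjk) (negbTE kT).
rewrite /G E1 E2 setUCA exprS !scalerA -scalerDl.
set a := (-1) ^+ _; set b := (-1) ^+ _.
suff -> : b * x`_k * a * x`_j = a * x`_j * b * x`_k.
  by rewrite mulN1r mulrN mulNr addNr scale0r.
by rewrite -[LHS]mulrA mulrC !mulrA.
Qed.

Definition koszul_cycle_pred (i : nat) : {pred koszul} :=
  fun f => koszul_degree i f && (koszul_diff f == 0).

Fact koszul_cycle_closed i : submod_closed (koszul_cycle_pred i).
Proof.
split; first by rewrite unfold_in linear0 eqxx andbT;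
  apply/koszul_degreeP => S _; rewrite ffunE.
move=> a f g; rewrite !unfold_in => /andP[fi /eqP f0] /andP[gi /eqP g0].
by rewrite koszul_degree_lin // koszul_diff_linear f0 g0 scaler0 addr0 eqxx.
Qed.
HB.instance Definition _ i :=
  GRing.isSubmodClosed.Build A koszul (koszul_cycle_pred i)
    (koszul_cycle_closed i).

Record koszul_cycle (i : nat) : Type := KoszulCycle {
  koszul_cycle_val :> koszul;
  _ : koszul_cycle_val \in koszul_cycle_pred i }.
HB.instance Definition _ i := [isSub for @koszul_cycle_val i].
HB.instance Definition _ i := [Choice of koszul_cycle i by <:].
HB.instance Definition _ i :=
  [SubChoice_isSubLmodule of koszul_cycle i by <:].

Definition koszul_boundary (i : nat) : {pred koszul_cycle i} :=
  fun z => `[< exists2 f, koszul_degree i.+1 f & koszul_diff f = val z >].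

Fact koszul_boundary_closed i : submod_closed (@koszul_boundary i).
Proof.
split.
  apply/asboolP; exists 0; last by rewrite !linear0.
  by apply/koszul_degreeP => S _; rewrite ffunE.
move=> a y z /asboolP[f fi fy] /asboolP[g gi gz]; apply/asboolP.
by exists (a *: f + g); [exact: koszul_degree_lin | rewrite !koszul_diff_linear fy gz].
Qed.
HB.instance Definition _ i :=
  GRing.isSubmodClosed.Build A (koszul_cycle i) (@koszul_boundary i)
    (@koszul_boundary_closed i).

Definition koszul_homology (i : nat) : Type :=
  {ideal_quot (@koszul_boundary i : zmodClosed (koszul_cycle i))}.
HB.instance Definition _ i := GRing.Zmodule.on (koszul_homology i).

Fact koszul_boundary_scale i a (z : koszul_cycle i) :
  z \in @koszul_boundary i -> a *: z \in @koszul_boundary i.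
Proof. exact: rpredZ. Qed.

HB.instance Definition _ i :=
  GRing.Zmodule_isLmodule.Build A (koszul_homology i)
    (quot_scaleA (@koszul_boundary_scale i))
    (quot_scale1 (@koszul_boundary_scale i))
    (quot_scaleDr (@koszul_boundary_scale i))
    (quot_scaleDl (@koszul_boundary_scale i)).

End Koszul.

(* Main.v *)
(* If z is a maximal A-regular sequence in mA, then H_i(z; P) = 0 for i > 0 and
   P projective, so shifting along a resolution gives H_i(z; M) = 0 for
   i > projdim M.  If y is a maximal M-regular sequence in I and N = M / (y)M,
   then H_i(z; N) = 0 for i > projdim M + g, while rigidity of the Koszul complex
   identifies H_{m-g}(I, M) with H = {v in N | I v = 0}, nonzero by maximality
   of y.  Since N / H embeds in a power of N, H inherits from N the vanishing of
   H_d(z; -) and H_{d-1}(z; -).  Vanishing of H_d(z; V) means that no nonzero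
   element of V is killed by (z); for V noetherian, prime avoidance over the
   maximal annihilators then produces a nonzerodivisor on V in (z). *)
Require Import Defs.
From HB Require Import structures.
From mathcomp Require Import all_boot all_order all_algebra finmap.
From mathcomp Require Import boolp zify ring monalg.

Set Implicit Arguments.
Unset Strict Implicit.
Unset Printing Implicit Defensive.

Import GRing.Theory.
Local Open Scope ring_scope.
Local Open Scope quotient_scope.

(** * Submodules and noetherian modules *)

(** Since z has exactly d entries, $H_d(z; V)$ and $H_{d-1}(z; V)$ are the top two Koszul homology
    modules; on nonzero noetherian modules their vanishing yields depth at least 1 and 2. Each entry
    of y costs one degree, so projdim M + g < d, respectively < d - 1, gives the vanishing for N.

    The map v -> (a v), a in x, has kernel H on N. If (z) kills v modulo H, each a v is killed by
    (z), hence zero, and v lies in H; thus $H_d(z; N/H) = 0$. The exact sequence $H_d(z; N/H) \to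
    H_{d-1}(z; H) \to H_{d-1}(z; N)$ then gives the second vanishing for H.

    Rigidity is built by hand. For a in I, exterior multiplication s is a homotopy from
    multiplication by a to zero on the Koszul complex of x, so c -> s c modulo a is a section of the
    connecting map $H_{i+1}(x; M/aM) \to H_i(x; M)$, and an isomorphism once $H_{i+1}(x; M) = 0$.
    Iterating over y moves degree m - g up to m, where the homology is an annihilator. *)

Definition submod (A : comNzRingType) (V : lmodType A) (S : V -> Prop) : Prop :=
  S 0 /\ forall a u v, S u -> S v -> S (a *: u + v).

Section SubQuotient.
Variables (A : comNzRingType) (V : lmodType A) (S : V -> Prop).
Hypothesis subS : submod S.

Definition submod_pred of submod S : {pred V} := fun v => `[< S v >].

Fact submod_pred_closed : submod_closed (submod_pred subS).
Proof.
case: subS => S0 SD; split; first exact/asboolP.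
by move=> a u v /asboolP Su /asboolP Sv; apply/asboolP/SD.
Qed.
HB.instance Definition _ :=
  GRing.isSubmodClosed.Build A V (submod_pred subS) submod_pred_closed.

Record submod_type : Type := SubmodType {
  submod_val :> V; _ : submod_val \in submod_pred subS }.
HB.instance Definition _ := [isSub for submod_val].
HB.instance Definition _ := [Choice of submod_type by <:].
HB.instance Definition _ := [SubChoice_isSubLmodule of submod_type by <:].

Definition submod_quot : Type :=
  {ideal_quot (submod_pred subS : zmodClosed V)}.
HB.instance Definition _ := GRing.Zmodule.on submod_quot.

Fact submod_pred_scale a v :
  v \in (submod_pred subS : zmodClosed V) ->
  a *: v \in (submod_pred subS : zmodClosed V).
Proof. exact: rpredZ. Qed.

HB.instance Definition _ :=
  GRing.Zmodule_isLmodule.Build A submod_quot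
    (quot_scaleA submod_pred_scale) (quot_scale1 submod_pred_scale)
    (quot_scaleDr submod_pred_scale) (quot_scaleDl submod_pred_scale).

Lemma submodule_exists :
  exists (K : lmodType A) (f : {linear K -> V}),
    injective f /\ forall v, S v <-> exists u, f u = v.
Proof.
exists submod_type, (\val : {linear submod_type -> V}); split; first exact: val_inj.
move=> v; split=> [Sv | [[u Su] <-]]; last exact/asboolP.
by have Sv' : v \in submod_pred subS by [apply/asboolP]; exists (SubmodType Sv').
Qed.

Definition submod_proj (v : V) : submod_quot :=
  \pi_{ideal_quot (submod_pred subS : zmodClosed V)} v.

Fact submod_proj_linear : linear submod_proj.
Proof.
move=> a u v; rewrite /submod_proj raddfD /=; congr (_ + _).
by rewrite -(pi_quot_scale submod_pred_scale).
Qed.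
HB.instance Definition _ :=
  GRing.isLinear.Build A V submod_quot _ submod_proj submod_proj_linear.

Lemma quotient_exists :
  exists (Q : lmodType A) (p : {linear V -> Q}),
    (forall q, exists v, p v = q) /\ forall v, p v = 0 <-> S v.
Proof.
exists submod_quot, submod_proj; split=> [q | v].
  by exists (repr q); rewrite /= /submod_proj reprK.
have E : (v \in submod_pred subS) = (submod_proj v == 0 :> submod_quot).
  rewrite -[v in LHS]subr0 -(linear0 submod_proj); exact: Quotient.idealrBE.
split=> [/eqP | Sv]; first by rewrite -E => /asboolP.
by apply/eqP; rewrite -E; apply/asboolP.
Qed.

End SubQuotient.

Section Submodules.
Variables (A : comNzRingType) (V : lmodType A).
Implicit Types (S : V -> Prop) (e : seq V) (u v w : V) (a : A) (s : seq A).

Lemma submodD S u v : submod S -> S u -> S v -> S (u + v).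
Proof. by move=> [_ SD] Su Sv; rewrite -[u]scale1r; apply: SD. Qed.

Lemma submodZ S a u : submod S -> S u -> S (a *: u).
Proof. by move=> [S0 SD] Su; rewrite -[_ *: _]addr0; apply: SD. Qed.

Lemma submodB S u v : submod S -> S u -> S v -> S (u - v).
Proof.
by move=> Sm Su Sv; apply: submodD => //; rewrite -scaleN1r; apply: submodZ.
Qed.

Lemma submod_sum S (I : finType) (F : I -> V) :
  submod S -> (forall i, S (F i)) -> S (\sum_i F i).
Proof.
by move=> Sm SF; apply: big_ind => //; [case: Sm | move=> u v; apply: submodD].
Qed.

(** The recursive form lets inductions peel off one generator at a time; [lspanP] reconciles it with
    the indexed sums of [generates]. With [V := A^o] it describes the ideal generated by a list. *)
Fixpoint lspan e v : Prop :=
  if e is w :: e' then exists a, lspan e' (v - a *: w) else v = 0.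

Lemma lspan_submod e : submod (lspan e).
Proof.
elim: e => [|w e [e0 eD]] /=; first by split=> // a u v -> ->; rewrite scaler0 addr0.
split=> [|a u v [b hu] [c hv]]; first by exists 0; rewrite scale0r subr0.
exists (a * b + c); have := eD a _ _ hu hv.
by rewrite scalerBr scalerDl opprD scalerA addrACA.
Qed.

Lemma lspan_mem e v : v \in e -> lspan e v.
Proof.
elim: e => //= w e IH; rewrite inE => /predU1P[-> | /IH ve].
  by exists 1; rewrite scale1r subrr; case: (lspan_submod e).
by exists 0; rewrite scale0r subr0.
Qed.

Lemma lspan_min S e v :
  submod S -> (forall u, u \in e -> S u) -> lspan e v -> S v.
Proof.
move=> Sm; elim: e v => [|w e IH] v /= eS; first by move=> ->; case: Sm.
case=> a /IH Sv; rewrite -[v](subrK (a *: w)); apply: submodD => //.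
  by apply: Sv => u ue; apply: eS; rewrite inE ue orbT.
by apply: submodZ => //; apply: eS; rewrite mem_head.
Qed.

Lemma lspanP e v :
  lspan e v <-> exists c : 'I_(size e) -> A, v = \sum_(i < size e) c i *: e`_i.
Proof.
split=> [|[c ->]]; last first.
  apply: submod_sum (lspan_submod e) _ => i.
  by apply: submodZ (lspan_submod e) _; apply: lspan_mem; rewrite mem_nth.
elim: e v => [|w e IH] v /=; first by move=> ->; exists (fun=> 0); rewrite big_ord0.
case=> a /IH[c vE]; exists (fun i => oapp c a (unlift ord0 i)).
rewrite big_ord_recl unlift_none /= -[LHS](subrK (a *: w)) vE addrC; congr (_ + _).
by apply: eq_bigr => i _; rewrite liftK.
Qed.

Lemma in_smul_nil v : in_smul [::] v <-> v = 0.
Proof. by split=> [[c ->]|->]; [|exists (fun=> 0)]; rewrite big_ord0. Qed.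

Lemma in_smul_cons a s v :
  in_smul (a :: s) v <-> exists u, in_smul s (v - a *: u).
Proof.
split=> [[c ->]|[u [c vE]]].
  exists (c ord0), (fun i => c (lift ord0 i)).
  by rewrite big_ord_recl /= addrC addKr.
exists (fun i => oapp c u (unlift ord0 i)).
rewrite big_ord_recl unlift_none /= -[LHS](subrK (a *: u)) vE addrC; congr (_ + _).
by apply: eq_bigr => i _; rewrite liftK.
Qed.

Lemma in_smul_submod s : submod (@in_smul A V s).
Proof.
elim: s => [|a s [s0 sD]].
  by split=> [|b u v]; rewrite !in_smul_nil // => -> ->; rewrite scaler0 addr0.
split=> [|b u v]; rewrite !in_smul_cons; first by exists 0; rewrite scaler0 subr0.
move=> [u' hu] [v' hv]; exists (b *: u' + v'); have := sD b _ _ hu hv.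
by rewrite scalerBr scalerDr opprD !scalerA (mulrC b) addrACA.
Qed.

Lemma in_smul_mem s a v : a \in s -> in_smul s (a *: v).
Proof.
elim: s => //= b s IH; rewrite inE in_smul_cons => /predU1P[-> | /IH as_].
  by exists v; rewrite subrr; case: (in_smul_submod s).
by exists 0; rewrite scaler0 subr0.
Qed.

Lemma in_smul_min S s v :
  submod S -> (forall a u, a \in s -> S (a *: u)) -> in_smul s v -> S v.
Proof.
move=> Sm sS [c ->]; apply: submod_sum => // i; apply: sS; exact: mem_nth.
Qed.

Lemma in_smul_sub s t v : {subset s <= t} -> in_smul s v -> in_smul t v.
Proof.
by move=> st; apply: in_smul_min (in_smul_submod t) _ => a u /st; apply: in_smul_mem.
Qed.

End Submodules.

Definition noeth (A : comNzRingType) (V : lmodType A) : Prop :=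
  forall S : V -> Prop, submod S ->
    exists e, (forall v, v \in e -> S v) /\ forall v, S v -> lspan e v.

Section Noetherian.
Variable A : comNzRingType.
Implicit Types V W : lmodType A.

Lemma noeth_chain V (S : nat -> V -> Prop) : noeth V ->
  (forall n, submod (S n)) -> (forall n v, S n v -> S n.+1 v) ->
  exists n, forall k v, S k v -> S n v.
Proof.
move=> nV Sm Sinc.
have Sle i j v : (i <= j)%N -> S i v -> S j v.
  by move=> /subnK <-; elim: (j - i)%N => // k IH /IH; apply: Sinc.
have [|e [eS Se]] := nV (fun v => exists n, S n v).
  split=> [|a u v [i iu] [j jv]]; first by exists 0; case: (Sm 0).
  exists (maxn i j); have [_] := Sm (maxn i j); apply.
    exact: Sle (leq_maxl i j) iu.
  exact: Sle (leq_maxr i j) jv.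
have [n en] : exists n, forall v, v \in e -> S n v.
  elim: e eS {Se} => [|w e IH] eS; first by exists 0.
  have [|n en] := IH; first by move=> v ve; apply: eS; rewrite inE ve orbT.
  have [j jw] := eS w (mem_head w e).
  exists (maxn n j) => v; rewrite inE => /predU1P[-> | /en nv].
    exact: Sle (leq_maxr n j) jw.
  exact: Sle (leq_maxl n j) nv.
exists n => k v kv; apply: lspan_min (Sm n) en _; apply: Se; by exists k.
Qed.

(** Otherwise choice assigns to each member of the family above [S0] a strictly larger one, and
    iterating from [S0] gives a chain that never stabilises. *)
Lemma noeth_maximal V (F : (V -> Prop) -> Prop) (S0 : V -> Prop) : noeth V ->
  (forall S, F S -> submod S) -> F S0 ->
  exists S, [/\ F S, forall v, S0 v -> S v &
    forall T, F T -> (forall v, S v -> T v) -> forall v, T v -> S v].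
Proof.
move=> nV Fm F0; apply: contrapT => nmax.
pose T := {S | F S /\ forall v, S0 v -> S v}.
have /choice[f fP] (S : T) : exists S' : T,
    (forall v, sval S v -> sval S' v) /\ ~ (forall v, sval S' v -> sval S v).
  case: S => S [FS S0S] /=; apply: contrapT => nex; apply: nmax.
  exists S; split=> // S' FS' SS' v S'v; apply: contrapT => nSv; apply: nex.
  exists (exist _ S' (conj FS' (fun v hv => SS' v (S0S v hv)))) => /=.
  by split=> // /(_ v S'v).
pose S n := iter n f (exist _ S0 (conj F0 (fun v hv => hv)) : T).
have [| |n nP] := @noeth_chain V (fun n => sval (S n)) nV.
- by move=> n; case: (svalP (S n)) => /Fm.
- by move=> n; case: (fP (S n)).
- by case: (fP (S n)) => _; apply=> v; apply: (nP n.+1).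
Qed.

Lemma noeth_surj V W (p : {linear V -> W}) :
  (forall w, exists v, p v = w) -> noeth V -> noeth W.
Proof.
move=> psurj nV S Sm; have [|e [eS Se]] := nV (fun v => S (p v)).
  split=> [|a u v pu pv]; first by rewrite linear0; case: Sm.
  by rewrite linearP; case: Sm => _; apply.
exists (map p e); split=> [w /mapP[v /eS pv ->] // | w Sw].
have [v vw] := psurj w; rewrite -vw in Sw *.
apply: (lspan_min (S := fun v => lspan (map p e) (p v))) (Se v Sw).
  split=> [|a u1 u2 pu pv].
    by rewrite linear0; case: (lspan_submod (map p e)).
  by rewrite linearP; case: (lspan_submod (map p e)) => _; apply.
by move=> u ue; apply: lspan_mem; apply: map_f.
Qed.

Lemma noeth_inj V W (f : {linear V -> W}) : injective f -> noeth W -> noeth V.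
Proof.
move=> finj nW S Sm; have [|e [eS Se]] := nW (fun w => exists2 v, S v & f v = w).
  split=> [|a _ _ [u Su <-] [v Sv <-]].
    by exists 0; rewrite ?linear0 //; case: Sm.
  by exists (a *: u + v); rewrite ?linearP //; case: Sm => _; apply.
have /choice[g gP] (w : W) : exists v, w \in e -> S v /\ f v = w.
  have [/eS [v Sv fv]|] := boolP (w \in e); first by exists v.
  by exists 0.
exists (map g e); split=> [v /mapP[w /gP[] Sg _ -> //] | v Sv].
have : lspan e (f v) by apply: Se; exists v.
rewrite -/((fun w => exists2 v, lspan (map g e) v & f v = w) (f v)) => h.
have [|w we|u ue /finj <- //] :=
    @lspan_min A W (fun w => exists2 v, lspan (map g e) v & f v = w) e _ _ _ h.
  have gm := lspan_submod (map g e).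
  split=> [|a _ _ [u1 Su <-] [v1 Sv1 <-]].
    by exists 0; rewrite ?linear0 //; case: gm.
  by exists (a *: u1 + v1); rewrite ?linearP //; case: gm => _; apply.
by exists (g w); [apply: lspan_mem; apply: map_f | case: (gP w we)].
Qed.

(** The coefficients on the head [w] of elements of [S] form an ideal. Lifts to [S] of its
    generators ([e2]), with generators of the part of [S] in the span of the tail ([e1]), generate
    [S]. *)
Lemma noeth_span V (e : seq V) : noeth A^o ->
  forall S : V -> Prop, submod S -> (forall v, S v -> lspan e v) ->
    exists e', (forall v, v \in e' -> S v) /\ forall v, S v -> lspan e' v.
Proof.
move=> nA; elim: e => [|w e IH] S Sm Se.
  by exists [::]; split=> // v /Se.
have em := lspan_submod e.
have [||e1 [e1S Se1]] := IH (fun v => S v /\ lspan e v); last 1 first.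
- have [|r [rS Sr]] := nA (fun a : A^o => exists2 v, lspan e v & S ((a : A) *: w + v)).
    split=> [|a b c [u eu Su] [v ev Sv]].
      by exists 0; rewrite ?scale0r ?addr0; [case: em | case: Sm].
    exists (a *: u + v); first by case: em => _; apply.
    rewrite scalerDl addrACA -scalerA -scalerDr; case: Sm => _; exact.
  have /choice[t tP] (a : A) : exists v, a \in r -> lspan e v /\ S (a *: w + v).
    by have [/rS[v]|] := boolP (a \in r); [exists v | exists 0].
  pose e2 := [seq a *: w + t a | a <- r].
  exists (e1 ++ e2); split=> [v | v Sv].
    by rewrite mem_cat => /orP[/e1S[] // | /mapP[a /tP[_ Sa] ->]].
  have [a ev] := Se v Sv.
  have /Sr ra : exists2 v, lspan e v & S (a *: w + v).
    by exists (v - a *: w) => //; rewrite addrC subrK.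
  have m12 := lspan_submod (e1 ++ e2).
  have [||u [eu Su u12]] := @lspan_min A A^o
     (fun a => exists u, [/\ lspan e u, S ((a : A) *: w + u) &
        lspan (e1 ++ e2) ((a : A) *: w + u)]) r a _ _ ra.
  + split=> [|b c1 c2 [u1 [eu1 Su1 u12]] [u2 [eu2 Su2 u22]]].
      by exists 0; rewrite scale0r addr0; split; [case: em | case: Sm | case: m12].
    exists (b *: u1 + u2); rewrite scalerDl addrACA -scalerA -scalerDr.
    by split; [case: em | case: Sm | case: m12] => _; apply.
  + move=> b br; exists (t b); have [et St] := tP b br; split=> //.
    apply: lspan_mem; rewrite mem_cat.
    by rewrite (map_f (fun a => a *: w + t a) br) orbT.
  rewrite -[v](subrK (a *: w + u)); apply: submodD => //.
  apply: (@lspan_min A V (lspan (e1 ++ e2)) e1) => //.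
    by move=> v1 v1e; apply: lspan_mem; rewrite mem_cat v1e.
  apply: Se1; split; first exact: submodB.
  by rewrite opprD addrA; apply: submodB.
- by split=> [|a u v [Su eu] [Sv ev]]; split;
    [case: Sm | case: em | case: Sm => _; apply | case: em => _; apply].
- by move=> v [].
Qed.

End Noetherian.

(** * Noetherian local rings and avoidance of annihilators *)

Section LocalRing.
Variable A : comNzRingType.
Implicit Types (V W : lmodType A) (J : idealr A).

Lemma idealr_exists (S : A^o -> Prop) :
  submod S -> ~ S 1 -> exists J, forall a, a \in J <-> S a.
Proof.
move=> [S0 SD] S1; pose P : {pred A} := fun a => `[< S a >].
have Pc : idealr_closed P.
  split; [exact/asboolP | exact/asboolP |].
  by move=> a u v /asboolP Su /asboolP Sv; apply/asboolP/SD.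
pose J : idealr A := HB.pack P (isIdealr.Build A P Pc).
by exists J => a; split=> [/asboolP | Sa] //; apply/asboolP.
Qed.

Lemma idealr_submod J : submod (fun a : A^o => a \in J).
Proof. by split=> [|a u v Ju Jv]; rewrite ?rpred0 // rpredD // idealMr. Qed.

Lemma generatesE (s : seq A) J y :
  generates s J -> (y \in J) <-> lspan (V := A^o) s y.
Proof. by move=> /(_ y) gs; rewrite lspanP. Qed.

Lemma noeth_ring : noetherian A -> noeth (A^o : lmodType A).
Proof.
move=> nA S Sm; have [S1|nS1] := pselect (S 1).
  exists [:: 1]; split=> [v | v _]; first by rewrite inE => /eqP ->.
  by exists v => /=; rewrite /GRing.scale /= mulr1 subrr.
have [J JS] := idealr_exists Sm nS1; have [s gs] := nA J.
exists s; split=> v.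
  by move=> vs; apply/JS/(generatesE _ gs)/lspan_mem.
by move=> /JS /(generatesE _ gs).
Qed.

Lemma noeth_fg V : noetherian A -> finitely_generated V -> noeth V.
Proof.
move=> nA [n [e eV]] S Sm; apply: (@noeth_span A V (codom e)) => //.
  exact: noeth_ring.
move=> v _; have [c ->] := eV v; have em := lspan_submod (codom e).
by apply: submod_sum => // i; apply: submodZ => //; apply: lspan_mem; apply: codom_f.
Qed.

Variable mA : idealr A.
Hypotheses (nA : noetherian A) (lA : local_ring mA).

(** A largest proper ideal above [S], obtained from noetherianity in place of Zorn's lemma, is
    maximal, so it is [mA]. *)
Lemma proper_sub_max (S : A^o -> Prop) :
  submod S -> ~ S 1 -> forall a, S a -> a \in mA.
Proof.
move=> Sm S1.
have [||P [[Pm P1] SP Pmax] a Sa] :=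
    @noeth_maximal A A^o (fun P => submod P /\ ~ P 1) S (noeth_ring nA).
- by move=> P [].
- by [].
have [J JP] := idealr_exists Pm P1.
rewrite -(lA.2 J) ?JP; first exact: SP.
move=> J' JJ' b bJ'; apply/JP; apply: (Pmax (fun b => b \in J')) => //.
  by split; [exact: idealr_submod | rewrite idealr1].
by move=> c /JP /JJ'.
Qed.

Lemma idealr_sub_max J : {subset J <= mA}.
Proof.
by apply: (proper_sub_max (idealr_submod J)); rewrite idealr1.
Qed.

Lemma unit_sub1 r : r \in mA -> exists b, b * (1 - r) = 1.
Proof.
move=> rm; apply: contrapT => nb.
suff : 1 \in mA by rewrite idealr1.
rewrite -[1](subrK r) rpredD //.
apply: (proper_sub_max (S := fun a : A^o => exists b, a = b * (1 - r))); last first.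
- by exists 1; rewrite mul1r.
- by case=> b bE; apply: nb; exists b.
split=> [|a _ _ [b ->] [c ->]]; first by exists 0; rewrite mul0r.
by exists (a * b + c); rewrite mulrDl -mulrA.
Qed.

(** Generators are discarded one by one: modulo the others, the head [w] equals [r *: w] with [r] in
    [mA], and [1 - r] is invertible. *)
Lemma nakayama V (s : seq A) : noeth V -> {subset s <= mA} ->
  (forall v : V, in_smul s v) -> forall v : V, v = 0.
Proof.
move=> nV sm sV.
have [|e [_ eV]] := nV (fun=> True); first by split.
have {eV} eV : forall v, lspan e v by move=> v; apply: eV.
elim: e eV => [|w e IH] eV //; apply: IH => v.
have em := lspan_submod e.
have wE : lspan e w.
  have [r rm ew] : exists2 r, r \in mA & lspan e (w - r *: w).
    apply: (@in_smul_min A V (fun v => exists2 r, r \in mA & lspan e (v - r *: w)) s)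
      (sV w) => [|a u as_].
      split=> [|a u1 u2 [b bm b1] [c cm c1]].
        by exists 0; rewrite ?rpred0 // scale0r subr0; case: em.
      exists (a * b + c); first by rewrite rpredD // idealMr.
      have := em.2 a _ _ b1 c1.
      by rewrite scalerBr scalerDl opprD scalerA addrACA.
    have [b bu] := eV u; exists (a * b); first by rewrite mulrC idealMr // sm.
    by rewrite -scalerA -scalerBr; apply: submodZ.
  have [b bE] := unit_sub1 rm.
  rewrite -[w]scale1r -bE -scalerA; apply: submodZ => //.
  by rewrite scalerBl scale1r.
have [a av] := eV v; rewrite -[v](subrK (a *: w)).
by apply: submodD => //; apply: submodZ.
Qed.

End LocalRing.

Definition nonzerodivisor (A : comNzRingType) (V : lmodType A) (a : A) : Prop :=
  forall v : V, a *: v = 0 -> v = 0.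

Section Avoidance.
Variables (A : comNzRingType) (V : lmodType A).
Hypotheses (nA : noetherian A) (nV : noeth V).

Definition ann_le (u v : V) : Prop := forall a : A, a *: u = 0 -> a *: v = 0.

(** The annihilators of such elements are the maximal associated primes of [V]; an element stands
    for its annihilator. *)
Definition max_ann (v : V) : Prop :=
  v <> 0 /\ forall w, w <> 0 -> ann_le v w -> ann_le w v.

Lemma ann_submod (v : V) : submod (fun a : A^o => (a : A) *: v = 0).
Proof.
split=> [|a b c hb hc]; first exact: scale0r.
by rewrite scalerDl -scalerA hb hc scaler0 addr0.
Qed.

Lemma max_ann_exists u : u <> 0 -> exists2 v, max_ann v & ann_le u v.
Proof.
move=> u0.
have [||S [[v v0 Sv] uS Smax]] := @noeth_maximal A A^o
    (fun S => exists2 v : V, v <> 0 & S = fun a => (a : A) *: v = 0)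
    (fun a => (a : A) *: u = 0) (noeth_ring nA).
- by move=> S [v _ ->]; apply: ann_submod.
- by exists u.
subst S; exists v => //; split=> // w w0 vw a aw.
by apply: (Smax _ _ vw a aw); exists w.
Qed.

(** The annihilator of [b *: v] contains that of [v], so by maximality they agree as soon as
    [b *: v] is nonzero. *)
Lemma max_ann_prime v a b :
  max_ann v -> a *: (b *: v) = 0 -> a *: v = 0 \/ b *: v = 0.
Proof.
move=> [v0 vmax] abv; have [bv|bv] := pselect (b *: v = 0); [by right | left].
by apply: (vmax _ bv) => // c cv; rewrite scalerA mulrC -scalerA cv scaler0.
Qed.

Lemma max_ann_separate v (e : seq V) : max_ann v ->
  (forall u, u \in e -> exists a : A, a *: u = 0 /\ a *: v <> 0) ->
  exists a : A, (forall u, u \in e -> a *: u = 0) /\ a *: v <> 0.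
Proof.
move=> mv; elim: e => [|w e IH] he; first by exists 1; rewrite scale1r; split=> //; case: mv.
have [u ue|a [ae av]] := IH; first by apply: he; rewrite inE ue orbT.
have [b [bw bv]] := he w (mem_head w e).
exists (a * b); split=> [u|]; rewrite -?scalerA.
  rewrite inE => /predU1P[-> | /ae au]; first by rewrite bw scaler0.
  by rewrite scalerA mulrC -scalerA au scaler0.
by move=> /(max_ann_prime mv)[].
Qed.

(* In the induction, an annihilator contained in that of the head u equals it by
   maximality, and then u can be dropped. *)
Lemma max_ann_avoid (e : seq V) (J : A^o -> Prop) : submod J ->
  (forall u, u \in e -> max_ann u) ->
  (forall u, u \in e -> exists2 a : A, J a & a *: u <> 0) ->
  exists2 a : A, J a & forall u, u \in e -> a *: u <> 0.
Proof.
move=> Jm; elim: e => [|u e IH] me Je; first by exists 0 => //; case: Jm.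
have eu w : w \in e -> w \in u :: e by move=> we; rewrite inE we orbT.
have [w /eu/me //|w /eu/Je //|y Jy ye] := IH.
have mu := me u (mem_head u e); have [b Jb bu] := Je u (mem_head u e).
have [yu|yu] := pselect (y *: u = 0); last first.
  by exists y => // w; rewrite inE => /predU1P[-> | /ye].
have [[w we wu]|nw] := pselect (exists2 w, w \in e & ann_le w u).
  case: (ye w we); have [_ wmax] := me w (eu w we).
  exact: (wmax u (proj1 mu) wu).
have [|a [ae au]] := @max_ann_separate u e mu.
  move=> w we; apply: contrapT => na; apply: nw; exists w => // a aw.
  by apply: contrapT => au; apply: na; exists a.
(* [a] kills the tail but not [u]: adding [a * b] leaves the action on the tail unchanged, and
   primeness makes it nonzero on [u]. *)
exists (y + a * b).
  exact: (@submodD A A^o J y (a * b) Jm Jy (@submodZ A A^o J a b Jm Jb)).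
move=> w; rewrite inE => /predU1P[-> | we]; rewrite scalerDl.
  by rewrite yu add0r -scalerA => /(max_ann_prime mu)[].
by rewrite mulrC -scalerA ae // scaler0 addr0; apply: ye.
Qed.

(** Finitely many maximal annihilators suffice: choose [e] whose span is largest, so that it
    contains every [max_ann] element. If no annihilator from [e] lay inside that of such a [v], some
    [b] would kill [e], hence [v], without killing [v]. So an [a] outside the annihilators from [e]
    is outside all maximal ones. *)
Lemma nonzerodivisor_exists (J : A^o -> Prop) : submod J ->
  (forall v : V, (forall a : A, J a -> a *: v = 0) -> v = 0) ->
  exists2 a : A, J a & nonzerodivisor V a.
Proof.
move=> Jm JV; have [e me emax] : exists2 e, forall u, u \in e -> max_ann u &
    forall v, max_ann v -> lspan e v.
  pose F S := exists2 e, forall u, u \in e -> max_ann u & S = @lspan A V e.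
  have [||S [[e me ->] _ emax]] := @noeth_maximal A V F (lspan [::]) nV.
  - by move=> _ [e _ ->]; apply: lspan_submod.
  - by exists [::].
  exists e => // v mv; apply: (emax (lspan (v :: e))).
  - by exists (v :: e) => // u; rewrite inE => /predU1P[-> | /me].
  - by move=> w ew; exists 0; rewrite scale0r subr0.
  - by apply: lspan_mem; rewrite mem_head.
have [u /me [u0 _]|a Ja ae] := @max_ann_avoid e J Jm me.
  apply: contrapT => na; apply: u0; apply: JV => a Ja.
  by apply: contrapT => au; apply: na; exists a.
exists a => // u au; apply: contrapT => /max_ann_exists[v mv uv].
have [u' u'e u'v] : exists2 u', u' \in e & ann_le u' v.
  apply: contrapT => nu'; have [|b [be bv]] := @max_ann_separate v e mv.
    move=> w we; apply: contrapT => na; apply: nu'; exists w => // b bw.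
    by apply: contrapT => bv; apply: na; exists b.
  apply: bv; apply: (@lspan_min A V (fun v => b *: v = 0) e) (emax v mv) => //.
  split=> [|c x y bx by_]; first exact: scaler0.
  by rewrite scalerDr by_ scalerA mulrC -scalerA bx scaler0 addr0.
case: (ae u' u'e); have [_ u'max] := me u' u'e.
exact: (u'max v (proj1 mv) u'v a (uv a au)).
Qed.

End Avoidance.

(** * Regular sequences *)

(** Properness is left out so that the notion also covers zero modules, such as the vanishing terms
    of a resolution. *)
Definition weakly_regular (A : comNzRingType) (V : lmodType A) (s : seq A) : Prop :=
  forall k, (k < size s)%N ->
    forall v : V, in_smul (take k s) (s`_k *: v) -> in_smul (take k s) v.

Definition surj (T U : Type) (f : T -> U) : Prop := forall y, exists x, f x = y.

Section WeaklyRegular.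
Variable A : comNzRingType.
Implicit Types (V W : lmodType A) (a : A) (s t : seq A).

Lemma in_smul_map V W (f : {linear V -> W}) s v : in_smul s v -> in_smul s (f v).
Proof.
apply: (in_smul_min (S := fun v => in_smul s (f v))) => [|a u as_].
  have sm := in_smul_submod W s.
  split=> [|a u1 u2 h1 h2]; first by rewrite linear0; case: sm.
  by rewrite linearP; case: sm => _; apply.
by rewrite linearZ; apply: in_smul_mem.
Qed.

Lemma in_smul_lift V W (p : {linear V -> W}) s w :
  surj p -> in_smul s w -> exists2 v, in_smul s v & p v = w.
Proof.
move=> ps; have sm := in_smul_submod V s.
apply: (in_smul_min (S := fun w => exists2 v, in_smul s v & p v = w)) => [|a u as_].
  split=> [|a _ _ [u1 h1 <-] [u2 h2 <-]].
    by exists 0; [case: sm | rewrite linear0].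
  by exists (a *: u1 + u2); [case: sm => _; apply | rewrite linearP].
by have [v <-] := ps u; exists (a *: v); [apply: in_smul_mem | rewrite linearZ].
Qed.

Lemma quotient_mul_exists V a : exists (Q : lmodType A) (p : {linear V -> Q}),
  surj p /\ forall v, p v = 0 <-> exists u, a *: u = v.
Proof.
apply: quotient_exists; split=> [|b _ _ [u1 <-] [u2 <-]]; first by exists 0; rewrite scaler0.
by exists (b *: u1 + u2); rewrite scalerDr !scalerA mulrC.
Qed.

Section QuotientMul.
Variables (V W : lmodType A) (p : {linear V -> W}) (a : A).
Hypotheses (ps : surj p) (pa : forall v, p v = 0 <-> exists u, a *: u = v).

Lemma in_smul_quotient t v : in_smul (a :: t) v <-> in_smul t (p v).
Proof.
rewrite in_smul_cons; split=> [[u /(in_smul_map p)] | /(in_smul_lift ps)[v' tv' pv]].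
  by rewrite linearB (_ : p (a *: u) = 0) ?subr0 //; apply/pa; exists u.
have [|u uE] := (pa (v - v')).1; first by rewrite linearB pv subrr.
by exists u; rewrite uE subKr.
Qed.

Lemma weakly_regular_cons t :
  weakly_regular V (a :: t) <-> nonzerodivisor V a /\ weakly_regular W t.
Proof.
split=> [wr | [na wr] [|k] /= kt v]; last first.
- rewrite !in_smul_quotient linearZ; exact: wr.
- by rewrite !in_smul_nil; apply: na.
split=> [v av | k kt w].
  by have := wr 0%N isT v; rewrite /= !in_smul_nil; apply.
have [v <-] := ps w; rewrite -linearZ -!in_smul_quotient.
exact: (wr k.+1).
Qed.

End QuotientMul.

Lemma regular_seq1 V a :
  nonzerodivisor V a -> (exists v : V, ~ in_smul [:: a] v) -> regular_seq V [:: a].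
Proof.
move=> na nv; split=> // -[|//] _ v /=; rewrite !in_smul_nil; exact: na.
Qed.

Lemma weakly_regular_rcons V s a : weakly_regular V s ->
  (forall v : V, in_smul s (a *: v) -> in_smul s v) -> weakly_regular V (rcons s a).
Proof.
move=> ws sa k; rewrite size_rcons ltnS leq_eqVlt => /predU1P[-> | ks] v.
  by rewrite nth_rcons ltnn eqxx -cats1 take_size_cat //; apply: sa.
by rewrite nth_rcons ks -cats1 takel_cat ?(ltnW ks) //; apply: ws.
Qed.

(** Among the regular sequences in [J] at least as long as [s], take [t] generating a largest ideal.
    If [rcons t y] were regular, [y] would lie in [(t)], and being a nonzerodivisor modulo [(t)]
    would force [V = (t)V]. The sequence [t] need not extend [s]; only its length matters for
    depth. *)
Lemma maximal_regular_seq_exists V (J : idealr A) s : noetherian A ->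
  {subset s <= J} -> regular_seq V s ->
  exists2 t, maximal_regular_seq V J t & (size s <= size t)%N.
Proof.
move=> nA sJ rs.
pose F S := exists t, [/\ {subset t <= J}, regular_seq V t, (size s <= size t)%N &
  S = @in_smul A A^o t].
have [||S [[t [tJ rt st ->]] _ tmax]] := @noeth_maximal A A^o F (@in_smul A A^o s) (noeth_ring nA).
- by move=> _ [t [_ _ _ ->]]; apply: in_smul_submod.
- by exists s.
exists t => //; split=> // y yJ ry.
have ty : in_smul (M := A^o) t y.
  apply: (tmax (in_smul (M := A^o) (rcons t y))).
  - exists (rcons t y); split=> //; last by rewrite size_rcons leqW.
    by move=> z; rewrite mem_rcons inE => /predU1P[-> | /tJ].
  - by move=> v; apply: in_smul_sub => z zt; rewrite mem_rcons inE zt orbT.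
  - rewrite -[X in in_smul _ X]mulr1; apply: (in_smul_mem (V := A^o)).
    by rewrite mem_rcons mem_head.
have [wr [v []]] := ry; have := wr (size t).
rewrite size_rcons ltnS leqnn nth_rcons ltnn eqxx -cats1 take_size_cat // => /(_ isT v) h.
apply: (@in_smul_sub A V t); first by move=> z zt; rewrite mem_cat zt.
apply: h; case: ty => c ->; rewrite scaler_suml.
apply: submod_sum (in_smul_submod V t) _ => i.
by rewrite -scalerA; apply: in_smul_mem; rewrite mem_nth.
Qed.

End WeaklyRegular.

Lemma linear_bundle (A : comNzRingType) (V W : lmodType A) (f : V -> W) :
  linear f -> exists g : {linear V -> W}, g =1 f.
Proof.
move=> lf; pose g : {linear V -> W} := HB.pack f (GRing.isLinear.Build A V W _ f lf).
by exists g.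
Qed.

(** * The Koszul complex *)

Section Koszul.
Variables (A : comNzRingType) (x : seq A).
Local Notation n := (size x).
Implicit Types M N K P : lmodType A.

Lemma koszul_degree_submod M i : submod (fun c : koszul M x => koszul_degree i c).
Proof.
split=> [|a c e ci ei]; last exact: koszul_degree_lin.
by apply/koszul_degreeP => S _; rewrite ffunE.
Qed.

Definition koszul_map M N (f : M -> N) (c : koszul M x) : koszul N x :=
  [ffun S => f (c S)].

Lemma koszul_map_linear M N (f : {linear M -> N}) : linear (koszul_map f).
Proof. by move=> a c e; apply/ffunP => S; rewrite !ffunE linearP. Qed.

Lemma koszul_diff_map M N (f : {linear M -> N}) (c : koszul M x) :
  koszul_diff (koszul_map f c) = koszul_map f (koszul_diff c).
Proof.
apply/ffunP => T; rewrite !ffunE linear_sum; apply: eq_bigr => j _.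
by rewrite ffunE -!(linearZ_LR f).
Qed.

Lemma koszul_degree_map M N (f : {linear M -> N}) i (c : koszul M x) :
  koszul_degree i c -> koszul_degree i (koszul_map f c).
Proof.
by move=> /koszul_degreeP ci; apply/koszul_degreeP => S Si; rewrite ffunE ci // linear0.
Qed.

Lemma koszul_choice M N (R : M -> N -> Prop) i (c : koszul M x) :
  R 0 0 -> koszul_degree i c -> (forall S, exists v, R (c S) v) ->
  exists2 e : koszul N x, koszul_degree i e & forall S, R (c S) (e S).
Proof.
move=> R0 /koszul_degreeP ci /choice[f fR].
exists [ffun S : {set 'I_n} => if #|S| == i then f S else 0].
  by apply/koszul_degreeP => S /eqP/negPf Si; rewrite ffunE Si.
by move=> S; rewrite ffunE; case: eqP => [_|/ci -> //].
Qed.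

Lemma koszul_map_lift M N (f : {linear M -> N}) i (c : koszul N x) :
  koszul_degree i c -> (forall S, exists v, f v = c S) ->
  exists2 e, koszul_degree i e & koszul_map f e = c.
Proof.
move=> ci cf; have [||e ei eE] := @koszul_choice N M (fun w v => f v = w) i c _ ci.
- by rewrite linear0.
- by [].
by exists e => //; apply/ffunP => S; rewrite ffunE eE.
Qed.

(** Left exterior multiplication by the basis vector $e_l$, read off at the coefficient of $e_S$. *)
Definition koszul_wedge M (l : 'I_n) (c : koszul M x) : koszul M x :=
  [ffun S : {set 'I_n} => if l \in S then (-1) ^+ #|[set k in S | (k < l)%N]| *: c (S :\ l) else 0].

Lemma koszul_wedge_linear M l : linear (@koszul_wedge M l).
Proof.
move=> a c e; apply/ffunP => S; rewrite !ffunE; case: ifP => _.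
  by rewrite scalerDr !scalerA mulrC.
by rewrite scaler0 addr0.
Qed.

Lemma koszul_degree_wedge M l i (c : koszul M x) :
  koszul_degree i c -> koszul_degree i.+1 (koszul_wedge l c).
Proof.
move=> /koszul_degreeP ci; apply/koszul_degreeP => S Si; rewrite ffunE.
case: ifP => // lS; rewrite ci ?scaler0 // => Sl; apply: Si.
by rewrite (cardsD1 l) lS Sl.
Qed.

(** The differential is contraction with the form $e_j \mapsto x_j$, an antiderivation: $d(e_l
    \wedge c) = x_l c - e_l \wedge d c$. *)
Lemma koszul_wedge_diff M l (c : koszul M x) :
  koszul_diff (koszul_wedge l c) + koszul_wedge l (koszul_diff c) = x`_l *: c.
Proof.
have sgn2 k : (-1) ^+ k * (-1) ^+ k = 1 :> A by rewrite -expr2 sqrr_sign.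
have sub1 (T : {set 'I_n}) (j : 'I_n) : [set k in j |: T | (k < j)%N] = [set k in T | (k < j)%N].
  apply/setP => k; rewrite !inE; case: eqVneq => //= ->.
  by rewrite ltnn andbF.
apply/ffunP => T; rewrite !ffunE.
case: (boolP (l \in T)) => lT; last first.
  rewrite addr0 (bigD1 l) //= ffunE setU11 sub1 setU1K // big1 ?addr0 => [|j /andP[jT jl]].
    by rewrite !scalerA mulrAC sgn2 mul1r.
  by rewrite ffunE !inE (negPf lT) eq_sym (negPf jl) /= !scaler0.
rewrite [X in _ + _ *: X](bigD1 l) /=; last by rewrite !inE eqxx.
rewrite setD1K // scalerDr addrCA.
have <- : [set k in l |: (T :\ l) | (k < l)%N] = [set k in T :\ l | (k < l)%N].
  by rewrite sub1.
rewrite setD1K // !scalerA sgn2 mul1r -[RHS]addr0; congr (_ + _).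
rewrite scaler_sumr [X in _ + X](eq_bigl (fun j => j \notin T)); last first.
  move=> j; rewrite !inE negb_and negbK; case: eqVneq => [->|] //=; first by rewrite lT.
  by rewrite andbT.
rewrite -big_split big1 //= => j jT.
have jl : j != l by apply: contraNneq jT => ->.
rewrite ffunE !inE lT orbT !scalerA.
have -> : (j |: T) :\ l = j |: (T :\ l).
  by apply/setP => k; rewrite !inE; case: (eqVneq k l) => // ->; rewrite eq_sym (negPf jl).
rewrite -scalerDl (_ : _ + _ = 0) ?scale0r //.
have jlv : val j != val l by rewrite (inj_eq val_inj).
(* Adding [j] and removing [l] shifts exactly one of the two sign exponents by one, whichever of [j]
   and [l] is smaller, so the terms cancel. *)
case: (ltnP j l) => [lt|le].
  have -> : #|[set k in j |: T | (k < l)%N]| = #|[set k in T | (k < l)%N]|.+1.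
    rewrite (_ : [set k in j |: T | _] = j |: [set k in T | (k < l)%N]).
      by rewrite cardsU1 inE (negPf jT).
    by apply/setP => k; rewrite !inE; case: (eqVneq k j) => [->|].
  have -> : [set k in T :\ l | (k < j)%N] = [set k in T | (k < j)%N].
    apply/setP => k; rewrite !inE; case: (eqVneq k l) => [->|] //=.
    by rewrite ltnNge (ltnW lt) andbF.
  by rewrite exprS; ring.
have {}le : (l < j)%N by rewrite ltn_neqAle eq_sym jlv le.
have -> : [set k in j |: T | (k < l)%N] = [set k in T | (k < l)%N].
  apply/setP => k; rewrite !inE; case: (eqVneq k j) => [->|] //=.
  by rewrite ltnNge (ltnW le) andbF.
have -> : #|[set k in T | (k < j)%N]| = #|[set k in T :\ l | (k < j)%N]|.+1.
  rewrite (cardsD1 l) !inE lT le add1n; congr (_.+1); apply: eq_card => k.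
  by rewrite !inE andbA.
by rewrite exprS; ring.
Qed.

(** Take exterior multiplication by $\sum_l b_l e_l$, where $a = \sum_l b_l x_l$. The homotopy
    itself, and not only the vanishing of [a] on homology, is used below. *)
Lemma koszul_homotopy M a : lspan (V := A^o) x a ->
  exists s : {linear koszul M x -> koszul M x},
    (forall i c, koszul_degree i c -> koszul_degree i.+1 (s c)) /\
    forall c, koszul_diff (s c) + s (koszul_diff c) = a *: c.
Proof.
move=> /lspanP[b ->].
have [|s sE] := @linear_bundle A (koszul M x) (koszul M x)
    (fun c => \sum_l b l *: koszul_wedge l c).
  move=> r c e; rewrite scaler_sumr -big_split; apply: eq_bigr => l _ /=.
  by rewrite koszul_wedge_linear scalerDr !scalerA mulrC.
exists s; split.
- move=> i c ci; rewrite sE; have dm := koszul_degree_submod M i.+1.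
  apply: (submod_sum dm) => l; apply: (submodZ _ dm); exact: koszul_degree_wedge.
move=> c; rewrite !sE linear_sum -big_split scaler_suml; apply: eq_bigr => l _ /=.
by rewrite linearZ -scalerDr koszul_wedge_diff scalerA.
Qed.

End Koszul.

(** * Vanishing of Koszul homology along short exact sequences *)

Definition short_exact (A : comNzRingType) (K P M : lmodType A)
    (f : {linear K -> P}) (g : {linear P -> M}) : Prop :=
  [/\ injective f, surj g & forall v, g v = 0 <-> exists u, f u = v].

(** Vanishing of $H_i(x; M)$, phrased on chains so that diagram chases avoid quotient modules. *)
Definition koszul_acyclic (A : comNzRingType) (x : seq A) (M : lmodType A) (i : nat) :=
  forall c : koszul M x, koszul_degree i c -> koszul_diff c = 0 ->
    exists2 e, koszul_degree i.+1 e & koszul_diff e = c.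

Section KoszulHomology.
Variables (A : comNzRingType) (x : seq A).
Local Notation n := (size x).
Implicit Types M N K P : lmodType A.

HB.instance Definition _ M N (f : {linear M -> N}) :=
  GRing.isLinear.Build A (koszul M x) (koszul N x) _ (koszul_map f) (koszul_map_linear f).

Lemma koszul_map_inj M N (f : M -> N) : injective f -> injective (@koszul_map A x M N f).
Proof.
by move=> fi c e /ffunP ce; apply/ffunP => S; have := ce S; rewrite !ffunE => /fi.
Qed.

Lemma koszul_degree_gt M i (c : koszul M x) : koszul_degree i c -> (n < i)%N -> c = 0.
Proof.
move=> /koszul_degreeP ci ni; apply/ffunP => S; rewrite ffunE ci // => Si.
by have := subset_leq_card (subsetT S); rewrite Si cardsT card_ord leqNgt ni.
Qed.

Section ShortExact.
Variables (K P M : lmodType A) (f : {linear K -> P}) (g : {linear P -> M}).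
Hypothesis fg : short_exact f g.

Lemma koszul_lift_ker i (c : koszul P x) : koszul_degree i c -> koszul_map g c = 0 ->
  exists2 e, koszul_degree i e & koszul_map f e = c.
Proof.
case: fg => _ _ gf ci gc; apply: koszul_map_lift => // S; apply/gf.
by have /ffunP/(_ S) := gc; rewrite !ffunE.
Qed.

Lemma koszul_lift_quot i (c : koszul M x) : koszul_degree i c ->
  exists2 e, koszul_degree i e & koszul_map g e = c.
Proof. by case: fg => _ gs _ ci; apply: koszul_map_lift => // S; apply: gs. Qed.

Lemma koszul_map_comp (c : koszul K x) : koszul_map g (koszul_map f c) = 0.
Proof.
case: fg => _ _ gf; apply/ffunP => S; rewrite !ffunE.
by apply/gf; exists (c S).
Qed.

(** The stretch $H_{i+1}(P) \to H_{i+1}(M) \to H_i(K)$ of the long exact sequence. *)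
Lemma koszul_acyclic_quot i :
  koszul_acyclic x K i -> koszul_acyclic x P i.+1 -> koszul_acyclic x M i.+1.
Proof.
move=> hK hP c ci dc; have [e ei ec] := koszul_lift_quot ci.
have [||k ki kE] := @koszul_lift_ker i (koszul_diff e); first exact: koszul_diff_degree.
  by rewrite -koszul_diff_map ec.
have [//||l li lk] := hK k; rewrite ?ki //.
  case: fg => fi _ _; apply: (koszul_map_inj fi).
  by rewrite -koszul_diff_map kE koszul_diff_diff linear0.
have dm := koszul_degree_submod x P i.+1.
have [||h hi hE] := hP (e - koszul_map f l).
- by apply: (submodB dm) => //; apply: koszul_degree_map.
- by rewrite linearB /= koszul_diff_map lk kE subrr.
exists (koszul_map g h); first exact: koszul_degree_map.
by rewrite koszul_diff_map hE linearB /= koszul_map_comp subr0.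
Qed.

(** The stretch $H_{i+1}(M) \to H_i(K) \to H_i(P)$ of the long exact sequence. *)
Lemma koszul_acyclic_sub i :
  koszul_acyclic x M i.+1 -> koszul_acyclic x P i -> koszul_acyclic x K i.
Proof.
move=> hM hP c ci dc; case: (fg) => fi _ _.
have [||e ei ec] := hP (koszul_map f c); first exact: koszul_degree_map.
  by rewrite koszul_diff_map dc linear0.
have [||h hi hE] := hM (koszul_map g e); first exact: koszul_degree_map.
  by rewrite koszul_diff_map ec koszul_map_comp.
have [h' h'i h'E] := koszul_lift_quot hi.
have dm := koszul_degree_submod x P i.+1.
have [||k ki kE] := @koszul_lift_ker i.+1 (e - koszul_diff h').
- by apply: (submodB dm) => //; apply: koszul_diff_degree.
- by rewrite linearB /= -koszul_diff_map h'E hE subrr.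
exists k => //; apply: (koszul_map_inj fi).
by rewrite -koszul_diff_map kE linearB /= koszul_diff_diff subr0.
Qed.

End ShortExact.

Lemma short_exact_mul M N (p : {linear M -> N}) a : nonzerodivisor M a -> surj p ->
  (forall v, p v = 0 <-> exists u, a *: u = v) ->
  short_exact (GRing.scale a : {linear M -> M}) p.
Proof.
move=> na ps pa; split=> // u v /eqP; rewrite -subr_eq0 -scalerBr => /eqP/na/eqP.
by rewrite subr_eq0 => /eqP.
Qed.

Lemma koszul_map_scale M a (c : koszul M x) : koszul_map (GRing.scale a) c = a *: c.
Proof. by apply/ffunP => S; rewrite !ffunE. Qed.

(** * Passing from M to M/aM for a regular element a of (x) *)

Section WedgeStep.
Variables (M N : lmodType A) (a : A) (p : {linear M -> N}).
Variable (s : {linear koszul M x -> koszul M x}).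
Hypotheses (na : nonzerodivisor M a) (ps : surj p).
Hypothesis pa : forall v, p v = 0 <-> exists u, a *: u = v.
Hypothesis s_deg : forall i c, koszul_degree i c -> koszul_degree i.+1 (s c).
Hypothesis s_diff : forall c, koszul_diff (s c) + s (koszul_diff c) = a *: c.

Let ap := short_exact_mul na ps pa.

(** A cycle [c] satisfies d(s c) = a c, which [p] kills. The same equation shows that the connecting
    map sends the class of p(s c) back to that of [c]. *)
Lemma wedge_step_cycle c : koszul_diff c = 0 -> koszul_diff (koszul_map p (s c)) = 0.
Proof.
move=> dc; rewrite koszul_diff_map -[koszul_diff _]addr0 -(linear0 s) -dc s_diff.
by rewrite -koszul_map_scale (koszul_map_comp ap).
Qed.

Lemma wedge_step_boundary i c : koszul_degree i c -> koszul_diff c = 0 ->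
  (exists2 e, koszul_degree i.+2 e & koszul_diff e = koszul_map p (s c)) <->
  (exists2 e, koszul_degree i.+1 e & koszul_diff e = c).
Proof.
move=> ci dc; have ai : injective (fun c : koszul M x => a *: c).
  move=> u v; rewrite -!koszul_map_scale; apply: koszul_map_inj; by case: ap.
split=> [[e ei eE] | [e ei eE]].
  have [e' e'i e'E] := koszul_lift_quot ap ei.
  have [||k ki kE] := @koszul_lift_ker _ _ _ _ _ ap i.+1 (s c - koszul_diff e').
  - apply: (submodB (koszul_degree_submod x M i.+1)); first exact: s_deg.
    exact: koszul_diff_degree.
  - by rewrite linearB /= -koszul_diff_map e'E eE subrr.
  exists k => //; apply: ai; rewrite -linearZ -koszul_map_scale kE linearB /=.
  by rewrite koszul_diff_diff subr0 -s_diff dc linear0 addr0.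
(* The sign comes from d(s e) = a e - s c, where [p] kills a e. *)
exists (- koszul_map p (s e)).
  rewrite -scaleN1r; apply: (submodZ _ (koszul_degree_submod x N i.+2)).
  by apply: koszul_degree_map; apply: s_deg.
rewrite linearN /= koszul_diff_map -linearN /=.
apply/eqP; rewrite -subr_eq0 -linearB -opprD -eE s_diff.
by rewrite linearN /= -koszul_map_scale (koszul_map_comp ap) oppr0.
Qed.

(** Lift [e] to [e'] with d e' = a c. Since also d(s c) = a c, the difference e' - s c is a cycle
    over [M], hence a boundary. *)
Lemma wedge_step_surj i e : koszul_acyclic x M i.+1 ->
  koszul_degree i.+1 e -> koszul_diff e = 0 ->
  exists c f, [/\ koszul_degree i c, koszul_diff c = 0, koszul_degree i.+2 f &
    koszul_diff f = e - koszul_map p (s c)].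
Proof.
move=> hM ei de; have [e' e'i e'E] := koszul_lift_quot ap ei.
have [||c ci cE] := @koszul_lift_ker _ _ _ _ _ ap i (koszul_diff e').
- exact: koszul_diff_degree.
- by rewrite -koszul_diff_map e'E.
have dc : koszul_diff c = 0.
  case: ap => /koszul_map_inj ai _ _; apply: ai.
  by rewrite -koszul_diff_map cE koszul_diff_diff linear0.
have [||f fi fE] := hM (e' - s c).
- by apply: (submodB (koszul_degree_submod x M i.+1)) => //; apply: s_deg.
- rewrite linearB /= -cE koszul_map_scale -s_diff dc linear0 addr0; exact: subrr.
exists c, (koszul_map p f); split=> //; first exact: koszul_degree_map.
by rewrite koszul_diff_map fE linearB /= e'E.
Qed.

End WedgeStep.

(** Dividing by each entry of [y] moves the cycle up one degree without losing its class, until the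
    degree exceeds [n], where there are no nonzero chains. *)
Lemma koszul_acyclic_regular (y : seq A) M i : weakly_regular M y ->
  (forall a, a \in y -> lspan (V := A^o) x a) -> (n < i + size y)%N ->
  koszul_acyclic x M i.
Proof.
elim: y M i => [|a y IH] M i wy xy /= ni c ci dc.
  rewrite addn0 in ni; exists 0; last by rewrite linear0 (koszul_degree_gt ci).
  by case: (koszul_degree_submod x M i.+1).
have [N [p [ps pa]]] := quotient_mul_exists M a.
have [na wy'] := (weakly_regular_cons ps pa y).1 wy.
have [s [s_deg s_diff]] := koszul_homotopy M (xy a (mem_head a y)).
apply/(wedge_step_boundary na ps pa s_deg s_diff ci dc).
apply: (IH N i.+1) => //.
- by move=> b by_; apply: xy; rewrite inE by_ orbT.
- by rewrite addSnnS.
- by apply: koszul_degree_map; apply: s_deg.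
- exact: (wedge_step_cycle na ps pa s_diff).
Qed.

Lemma koszul_diff_top M (c : koszul M x) : koszul_degree n c ->
  koszul_diff c = 0 <-> forall a, a \in x -> a *: c setT = 0.
Proof.
move=> /koszul_degreeP cn; split=> [dc a ax | xc].
  have lt : (index a x < n)%N by rewrite index_mem.
  pose j := Ordinal lt; have /ffunP/(_ (~: [set j])) := dc.
  rewrite !ffunE (bigD1 j) /=; last by rewrite !inE eqxx.
  rewrite big1 => [|k /andP[]]; last by rewrite !inE negbK => ->.
  rewrite addr0 setUCr nth_index //.
  move=> /(congr1 (fun v => (-1) ^+ #|[set k in ~: [set j] | (k < j)%N]| *: v)).
  by rewrite scaler0 scalerA -expr2 sqrr_sign scale1r.
apply/ffunP => T; rewrite !ffunE; apply: big1 => j jT.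
have [->|jTn] := eqVneq (j |: T) setT; first by rewrite xc ?scaler0 // mem_nth.
rewrite cn ?scaler0 // => jTc; case/eqP: jTn; apply/eqP.
by rewrite eqEcard subsetT cardsT card_ord jTc leqnn.
Qed.

Lemma koszul_top_exists M (v : M) :
  exists2 c : koszul M x, koszul_degree n c & c setT = v.
Proof.
exists [ffun S : {set 'I_n} => if S == setT then v else 0].
  apply/koszul_degreeP => S Sn; rewrite ffunE; case: eqP => // ST.
  by case: Sn; rewrite ST cardsT card_ord.
by rewrite ffunE eqxx.
Qed.

Lemma koszul_degree_top M (c : koszul M x) :
  koszul_degree n c -> c setT = 0 -> c = 0.
Proof.
move=> /koszul_degreeP cn c0; apply/ffunP => S; rewrite ffunE.
have [-> //|ST] := eqVneq S setT; apply: cn => Sn; case/eqP: ST; apply/eqP.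
by rewrite eqEcard subsetT cardsT card_ord Sn leqnn.
Qed.

Lemma koszul_acyclic_top M : koszul_acyclic x M n <->
  forall v : M, (forall a, a \in x -> a *: v = 0) -> v = 0.
Proof.
split=> [hM v xv | hM c cn dc].
  have [c cn cv] := koszul_top_exists v.
  rewrite -cv; have [|e en <-] := hM c cn; first by apply/koszul_diff_top; rewrite ?cv.
  by rewrite (koszul_degree_gt en) // linear0 ffunE.
exists 0; first by case: (koszul_degree_submod x M n.+1).
rewrite linear0; apply/esym/koszul_degree_top => //; apply: hM.
exact/koszul_diff_top.
Qed.

End KoszulHomology.

(** * Rigidity: Koszul homology as an annihilator *)

Section Rigidity.
Variables (A : comNzRingType) (x : seq A).
Local Notation n := (size x).
Implicit Types M N : lmodType A.

(** Carries vanishing through the induction of [koszul_rigidity], where [N] is built. The sequence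
    [z] is arbitrary because it will be the A-regular one, unrelated to [x]. *)
Definition acyclic_shift M N k : Prop := forall (z : seq A) b,
  (forall i, (b < i)%N -> koszul_acyclic z M i) ->
  forall i, (b + k < i)%N -> koszul_acyclic z N i.

(* [theta] induces an isomorphism of H_k(x; M) with the annihilator of (x) in
   N = M / (y)M. *)
Lemma koszul_rigidity (y : seq A) M k : weakly_regular M y ->
  (forall a, a \in y -> lspan (V := A^o) x a) -> (k + size y)%N = n ->
  exists (N : lmodType A) (p : {linear M -> N}) (theta : {linear koszul M x -> N}),
    [/\ surj p, forall v, p v = 0 <-> in_smul y v, acyclic_shift M N (size y),
      forall c, koszul_degree k c -> koszul_diff c = 0 ->
        theta c = 0 <-> exists2 e, koszul_degree k.+1 e & koszul_diff e = c &
      forall v, (forall a, a \in x -> a *: v = 0) <->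
        exists c, [/\ koszul_degree k c, koszul_diff c = 0 & theta c = v]].
Proof.
elim: y M k => [|a y IH] M k wy xy /= kn.
  rewrite addn0 in kn; subst k.
  have [|theta thetaE] := @linear_bundle A (koszul M x) M (fun c => c setT).
    by move=> b c e; rewrite !ffunE.
  exists M, idfun, theta; split=> [v|v|z b|c cn dc|v]; first by exists v.
  - by rewrite in_smul_nil.
  - by rewrite addn0.
  - rewrite thetaE; split=> [c0|[e en <-]].
      exists 0; first by case: (koszul_degree_submod x M n.+1).
      by rewrite linear0 (koszul_degree_top cn c0).
    by rewrite (koszul_degree_gt en) // linear0 ffunE.
  - split=> [xv|[c [cn dc <-]]]; last by rewrite thetaE; apply/koszul_diff_top.
    have [c cn cv] := koszul_top_exists x v; exists c; rewrite thetaE; split=> //.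
    by apply/koszul_diff_top; rewrite ?cv.
have [Q [q [qs qa]]] := quotient_mul_exists M a.
have [na wy'] := (weakly_regular_cons qs qa y).1 wy.
have [s [s_deg s_diff]] := koszul_homotopy M (xy a (mem_head a y)).
have xy' b : b \in y -> lspan (V := A^o) x b.
  by move=> by_; apply: xy; rewrite inE by_ orbT.
have [|N [p [theta [ps pa shift thetaB thetaI]]]] := IH Q k.+1 wy' xy'.
  by rewrite addSnnS.
(* The section into degree [k.+1] over [Q], followed by the map obtained for the shorter
   sequence. *)
have [|psi psiE] := @linear_bundle A (koszul M x) N (fun c => theta (koszul_map q (s c))).
  by move=> b c e; rewrite (linearP s) (koszul_map_linear q) linearP.
exists N, (p \o q : {linear M -> N}), psi; split.
- by move=> v; have [w <-] := ps v; have [u <-] := qs w; exists u.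
- by move=> v; rewrite (in_smul_quotient qs qa); apply: pa.
- move=> z b hM i; rewrite addnS -addSn => bi; apply: (shift z b.+1) bi.
  move=> [//|j] bj; apply: (koszul_acyclic_quot (short_exact_mul na qs qa)).
    by apply: hM.
  by apply: hM; apply: ltnW.
- move=> c ck dc; rewrite psiE.
  rewrite -(wedge_step_boundary na qs qa s_deg s_diff ck dc).
  apply: thetaB; first by apply: koszul_degree_map; apply: s_deg.
  exact: (wedge_step_cycle na qs qa s_diff).
- move=> v; rewrite thetaI; split=> [[e [ek de <-]] | [c [ck dc <-]]].
    (* Surjectivity needs $H_{k+1}(x; M) = 0$, and [k] is the last degree not covered by
       [koszul_acyclic_regular]. *)
    have [|c [f [ck dc fk fE]]] := wedge_step_surj na qs qa s_deg s_diff _ ek de.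
      by apply: koszul_acyclic_regular wy xy _; rewrite /= -kn addSn.
    exists c; split=> //; rewrite psiE; apply/esym/eqP; rewrite -subr_eq0 -linearB -fE.
    by apply/eqP/thetaB; [exact: koszul_diff_degree | exact: koszul_diff_diff | exists f].
  exists (koszul_map q (s c)); split; last by rewrite psiE.
    by apply: koszul_degree_map; apply: s_deg.
  exact: (wedge_step_cycle na qs qa s_diff).
Qed.

End Rigidity.

(** * Projective modules *)

Section Projective.
Variable A : comNzRingType.

Section FreeCover.
Variable P : lmodType A.
Local Notation F := ({malg A[P]} : lmodType A).

(** The canonical map onto [P] from the free module on all its elements; the basis may be infinite,
    so [P] need not be finitely generated. *)
Definition malg_eval (g : {malg A[P]}) : P := \sum_(v <- msupp g) g@_v *: v.

Lemma malg_evalE (g : {malg A[P]}) (D : {fset P}) : (msupp g `<=` D)%fset ->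
  malg_eval g = \sum_(v <- D) g@_v *: v.
Proof.
move=> gD; apply: big_fset_incl => // v _ /mcoeff_outdom ->; exact: scale0r.
Qed.

Lemma malg_eval_linear : linear malg_eval.
Proof.
move=> a g h; pose D := (msupp g `|` msupp h `|` msupp (a *: g + h))%fset.
rewrite (@malg_evalE g D) ?(@malg_evalE h D) ?(@malg_evalE (a *: g + h) D); first 1 last.
- exact: fsubsetUr.
- by rewrite /D -fsetUA fsetUCA fsubsetUl.
- by rewrite /D -fsetUA fsubsetUl.
rewrite scaler_sumr -big_split; apply: eq_bigr => v _ /=.
by rewrite mcoeffD mcoeffZ scalerDl scalerA.
Qed.

Lemma malg_eval_surj : surj malg_eval.
Proof.
move=> v; exists << 1 *g v >>.
by rewrite (malg_evalE (msuppU_le)) big_seq_fset1 mcoeffUU scale1r.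
Qed.

(** The coefficientwise choices are used on the support of [g] only, so they assemble into elements
    of finite support. *)
Lemma malg_in_smul (s : seq A) (g : F) :
  (forall v, in_smul (M := A^o) s (g@_v)) -> in_smul s g.
Proof.
move=> /choice[c cE].
rewrite (monalgE g).
exists (fun i => \sum_(v <- msupp g) << c v i *g v >>).
under [RHS]eq_bigr do rewrite scaler_sumr.
rewrite exchange_big /=; apply: eq_bigr => v _.
apply/malgP => u; rewrite (raddf_sum (mcoeff u)) mcoeffU cE mulrb.
case: eqP => [-> | uv].
  by apply: eq_bigr => i _; rewrite /= mcoeffZ mcoeffUU.
by rewrite big1 // => i _; rewrite /= mcoeffZ mcoeffU; case: eqP => //; rewrite mulr0.
Qed.

Lemma malg_weakly_regular (s : seq A) : weakly_regular (A^o : lmodType A) s -> weakly_regular F s.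
Proof.
move=> rs k ks g hg; apply: malg_in_smul => v; apply: (rs k ks).
rewrite -[_ *: _]/(s`_k * g@_v) -mcoeffZ.
apply: (in_smul_min (S := fun g : F => in_smul (M := A^o) (take k s) g@_v)) hg.
  have sm := in_smul_submod (A^o : lmodType A) (take k s).
  split=> [|a g1 g2 h1 h2]; first by rewrite mcoeff0; case: sm.
  by rewrite mcoeffD mcoeffZ; case: sm => _; apply.
move=> a h as_; rewrite mcoeffZ; exact: (in_smul_mem (V := A^o)).
Qed.

End FreeCover.

(** [P] is a retract of a free module: the section [h] carries the hypothesis there, and [f] brings
    the conclusion back. *)
Lemma projective_weakly_regular (P : lmodType A) (s : seq A) :
  projective P -> weakly_regular (A^o : lmodType A) s -> weakly_regular P s.
Proof.
move=> projP rs; have [f fE] := linear_bundle (@malg_eval_linear P).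
have fs : surj f by move=> v; have [g <-] := malg_eval_surj v; exists g; apply: fE.
have [h hE] := projP _ _ f idfun fs.
move=> k ks v /(in_smul_map h); rewrite linearZ => hv.
by have := malg_weakly_regular rs ks hv => /(in_smul_map f); rewrite hE.
Qed.

Lemma linear_factor (U V W : lmodType A) (i : {linear U -> W}) (f : {linear V -> W}) :
  injective i -> (forall v, exists u, i u = f v) ->
  exists g : {linear V -> U}, forall v, i (g v) = f v.
Proof.
move=> ii /choice[g gE]; have [|h hE] := @linear_bundle A V U g; last first.
  by exists h => v; rewrite hE.
by move=> a u v; apply: ii; rewrite linearP !gE linearP.
Qed.

Lemma koszul_acyclic_projective (z : seq A) (P : lmodType A) i :
  weakly_regular (A^o : lmodType A) z -> projective P -> (0 < i)%N ->
  koszul_acyclic z P i.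
Proof.
move=> rz projP i0; have rP := projective_weakly_regular projP rz.
apply: (koszul_acyclic_regular rP) => [a az|]; first exact: lspan_mem.
by rewrite -[X in (X < _)%N]add0n ltn_add2r.
Qed.

Lemma koszul_acyclic_projdim (z : seq A) p (M : lmodType A) :
  weakly_regular (A^o : lmodType A) z -> has_proj_resolution M p ->
  forall i, (p < i)%N -> koszul_acyclic z M i.
Proof.
move=> rz; elim: p M => [|p IH] M [P [d [e [projP P0 es ed dd]]]] [//|i] pi.
(* Both cases go through the first syzygy [K]: it is zero when the length is 0, and otherwise the
   truncated resolution, with [d 0] corestricted to [K], is one step shorter. *)
all: have km : submod (fun v => e v = 0) by
  split=> [|a u v eu ev]; rewrite ?linear0 // linearP eu ev scaler0 addr0.
all: have [K [f [fi fE]]] := submodule_exists km.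
all: apply: (@koszul_acyclic_quot A z K (P 0) M f e (And3 fi es fE));
  last exact: koszul_acyclic_projective.
  have K0 (c : koszul K z) : c = 0.
    apply/ffunP => S; rewrite ffunE; apply: fi; rewrite linear0.
    have /ed[y <-] := (fE (f (c S))).2 (ex_intro _ _ erefl).
    by rewrite (P0 1%N isT y); apply: linear0.
  move=> c ci _; exists 0; first by case: (koszul_degree_submod z K i.+1).
  by rewrite (K0 c) linear0.
apply: IH => //.
have [v|e' e'E] := linear_factor (f := d 0) fi.
  by apply/fE/ed; exists v.
exists (fun j => P j.+1), (fun j => d j.+1), e'; split=> //.
- by move=> j pj; apply: P0.
- move=> u; have /ed[y yE] := (fE (f u)).2 (ex_intro _ _ erefl).
  by exists y; apply: fi; rewrite e'E.
- move=> v; rewrite -dd -e'E; split=> [-> | h]; first exact: linear0.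
  by apply: fi; rewrite h linear0.
Qed.

End Projective.

(** * Depth of the Koszul homology *)

Section Homology.
Variables (A : comNzRingType) (x : seq A) (M : lmodType A).

(** $H_0(x; M)$ is M/(x)M. With Nakayama this later yields g <= m. *)
Lemma koszul_acyclic0 : koszul_acyclic x M 0 -> forall v : M, in_smul x v.
Proof.
move=> hM v; pose c : koszul M x := [ffun S : {set 'I_(size x)} => if S == set0 then v else 0].
have [||e e1 /ffunP/(_ set0)] := hM c.
- by apply/koszul_degreeP => S S0; rewrite ffunE; case: eqP S0 => // ->; rewrite cards0.
- apply/ffunP => T; rewrite !ffunE; apply: big1 => j _; rewrite ffunE.
  by case: eqP => [/setP/(_ j)|]; rewrite ?scaler0 // !inE eqxx.
rewrite !ffunE eqxx => <-; have sm := in_smul_submod M x.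
apply: big_ind => [|u w|j _]; [by case: sm | exact: submodD |].
by apply: submodZ => //; apply: in_smul_mem; rewrite mem_nth.
Qed.

(** Passes from chains to the quotient module of the statement. Cycles in one class differ by a
    boundary, so [theta] may be evaluated on any representative. *)
Lemma koszul_homology_embed (N : lmodType A) k (theta : {linear koszul M x -> N}) :
  (forall c, koszul_degree k c -> koszul_diff c = 0 ->
     theta c = 0 <-> exists2 e, koszul_degree k.+1 e & koszul_diff e = c) ->
  exists phi : {linear koszul_homology M x k -> N}, injective phi /\
    forall v, (exists q, phi q = v) <->
      exists c, [/\ koszul_degree k c, koszul_diff c = 0 & theta c = v].
Proof.
move=> thetaB.
pose B : zmodClosed (koszul_cycle M x k) := @koszul_boundary A M x k.
have thetaP (z : koszul_cycle M x k) : theta (val z) = 0 <-> z \in B.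
  case: z => c cP /=; have /andP[ck /eqP dc] := cP.
  by rewrite thetaB //; split=> [h | /asboolP //]; apply/asboolP.
have phiE (z : koszul_cycle M x k) :
    theta (val (repr (\pi_{ideal_quot B} z))) = theta (val z).
  apply/eqP; rewrite -subr_eq0 -linearB -linearB; apply/eqP/thetaP.
  by rewrite Quotient.idealrBE reprK.
have [|phi phiq] := @linear_bundle A (koszul_homology M x k) N
    (fun q => theta (val (repr (q : {ideal_quot B})))).
  move=> a u v; rewrite -[u]reprK -[v]reprK.
  rewrite [a *: _](pi_quot_scale (@koszul_boundary_scale A M x k)).
  by rewrite -raddfD !phiE !linearP.
exists phi; split=> [u v | v].
  move=> /eqP; rewrite -subr_eq0 -linearB phiq => /eqP/thetaP.
  rewrite -[X in X \in _]subr0 Quotient.idealrBE reprK => /eqP uv.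
  apply/eqP; rewrite -subr_eq0; apply/eqP.
  by rewrite [LHS]uv; apply: raddf0.
split=> [[q <-] | [c [ck dc <-]]].
  by rewrite phiq; case: (repr _) => c cP /=; have /andP[ck /eqP dc] := cP; exists c.
have cP : c \in koszul_cycle_pred k by apply/andP; split=> //; apply/eqP.
by exists (\pi_{ideal_quot B} (KoszulCycle cP)); rewrite phiq phiE.
Qed.

End Homology.

Section Depth.
Variables (A : comNzRingType) (mA : idealr A).
Hypotheses (nA : noetherian A) (lA : local_ring mA).

Lemma nakayama_neq0 (V : lmodType A) (s : seq A) : noeth V -> {subset s <= mA} ->
  (exists v : V, v <> 0) -> exists v : V, ~ in_smul s v.
Proof.
move=> nV sm [v v0]; apply: contrapT => h; apply: v0.
apply: (nakayama nA lA nV sm) => u; apply: contrapT => nu; apply: h; by exists u.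
Qed.

Lemma lspan_max (z : seq A) a : {subset z <= mA} -> lspan (V := A^o) z a -> a \in mA.
Proof. by move=> zm; apply: lspan_min (idealr_submod mA) zm. Qed.

Lemma nonzerodivisor_acyclic (V : lmodType A) (z : seq A) : noeth V ->
  koszul_acyclic z V (size z) ->
  exists2 a, lspan (V := A^o) z a & nonzerodivisor V a.
Proof.
move=> nV /koszul_acyclic_top zV.
apply: (nonzerodivisor_exists nA nV (lspan_submod (V := A^o) z)) => v zv.
by apply: zV => a az; apply: zv; apply: lspan_mem.
Qed.

Section Annihilator.
Variables (H N : lmodType A) (x z : seq A) (phi : {linear H -> N}).
Hypotheses (phi_inj : injective phi) (nN : noeth N).
Hypothesis phiE : forall v, (exists q, phi q = v) <-> forall a, a \in x -> a *: v = 0.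
Hypotheses (H0 : exists q : H, q <> 0) (zm : {subset z <= mA}).
Hypothesis zN : koszul_acyclic z N (size z).

Let nH : noeth H := noeth_inj phi_inj nN.

Let zN0 : forall v : N, (forall a, a \in z -> a *: v = 0) -> v = 0.
Proof. exact/koszul_acyclic_top. Qed.

Lemma annihilator_acyclic_top : koszul_acyclic z H (size z).
Proof.
apply/koszul_acyclic_top => q zq; apply: phi_inj; rewrite linear0.
by apply: zN0 => a az; rewrite -linearZ /= zq // linear0.
Qed.

(* N / H embeds in a power of N. *)
Lemma annihilator_acyclic j : size z = j.+1 -> koszul_acyclic z N j ->
  koszul_acyclic z H j.
Proof.
move=> zj hN; have xm : submod (fun v : N => forall a, a \in x -> a *: v = 0).
  split=> [a _|b u v xu xv a ax]; first exact: scaler0.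
  by rewrite scalerDr scalerA mulrC -scalerA xu // xv // scaler0 addr0.
have [C [p [ps pE]]] := quotient_exists xm.
have ex : short_exact phi p by split=> // v; rewrite pE phiE.
apply: (koszul_acyclic_sub ex) hN; rewrite -zj; apply/koszul_acyclic_top => w.
have [v <-] := ps w => zv; apply/pE => a ax; apply: zN0 => b bz.
have /pE/(_ a ax) : p (b *: v) = 0 by rewrite linearZ /= zv.
by rewrite !scalerA mulrC.
Qed.

Lemma annihilator_depth_ge1 : exists2 e, depth mA H e & (1 <= e)%N.
Proof.
have [a za na] := nonzerodivisor_acyclic nH annihilator_acyclic_top.
have am : {subset [:: a] <= mA}.
  by move=> b; rewrite inE => /eqP ->; apply: lspan_max za.
have ra := regular_seq1 na (nakayama_neq0 nH am H0).
have [t tmax ta] := maximal_regular_seq_exists nA am ra.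
by exists (size t) => //; exists t.
Qed.

(** For [a] regular on [H], $H_d(z; H/aH)$ sits between $H_d(z; H)$ and $H_{d-1}(z; H)$, both zero,
    so a second nonzerodivisor exists in (z). *)
Lemma annihilator_depth_ge2 j : size z = j.+1 -> koszul_acyclic z N j ->
  exists2 e, depth mA H e & (2 <= e)%N.
Proof.
move=> zj hN; have [a za na] := nonzerodivisor_acyclic nH annihilator_acyclic_top.
have [Q [q [qs qa]]] := quotient_mul_exists H a.
have nQ : noeth Q := noeth_surj qs nH.
have zQ : koszul_acyclic z Q (size z).
  rewrite zj; apply: (koszul_acyclic_quot (short_exact_mul na qs qa)).
    exact: annihilator_acyclic.
  by rewrite -zj; apply: annihilator_acyclic_top.
have [b zb nb] := nonzerodivisor_acyclic nQ zQ.
have abm : {subset [:: a; b] <= mA}.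
  move=> c; rewrite !inE => /orP[] /eqP ->; [exact: lspan_max za | exact: lspan_max zb].
have rab : regular_seq H [:: a; b].
  split; last exact: nakayama_neq0.
  apply/(weakly_regular_cons qs qa); split=> // -[|//] _ v /=.
  by rewrite !in_smul_nil; apply: nb.
have [t tmax tab] := maximal_regular_seq_exists nA abm rab.
by exists (size t) => //; exists t.
Qed.

End Annihilator.
End Depth.

Theorem theorem1p10 (A : comNzRingType) (mA : idealr A) (d : nat)
    (I : idealr A) (M : lmodType A) (m g : nat) (x : seq A) :
  cohen_macaulay_local mA ->
  krull_dim A d ->
  finitely_generated M ->
  (exists v : M, v <> 0) ->
  min_num_gens I m ->
  generates x I -> size x = m ->
  grade M I g ->
  ((exists2 p, projdim M p & p%:Z <= d%:Z - g%:Z - 1) ->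
    exists2 e, depth mA (koszul_homology M x (m - g)) e & (1 <= e)%N) /\
  ((exists2 p, projdim M p & p%:Z <= d%:Z - g%:Z - 2) ->
    exists2 e, depth mA (koszul_homology M x (m - g)) e & (2 <= e)%N).
Proof.
move=> [nA lA [d' [Pd d'max] [z [zm [rz _] _] zd]]] [Qd dmax] fgM M0 _ gx xm.
(* The dimension inside the Cohen-Macaulay hypothesis is its own [d']; each of [d], [d'] bounds the
   chain attaining the other. *)
have {d' Pd d'max dmax Qd} zd : size z = d.
  apply/eqP; rewrite zd eqn_leq; case: Pd Qd => P cP [Q cQ].
  by rewrite (dmax _ _ cP) (d'max _ _ cQ).
move=> [y [yI [ry _] ymax] yg].
have nM := noeth_fg nA fgM.
have Im := idealr_sub_max nA lA (J := I).
have xI a : a \in I <-> lspan (V := A^o) x a by apply: generatesE.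
have xy a : a \in y -> lspan (V := A^o) x a by move=> /yI/xI.
have xmA : {subset x <= mA} by move=> a ax; apply/Im/xI/lspan_mem.
(* This keeps the natural subtraction [m - g] from truncating: for m < g even $H_0(x; M)$ would
   vanish, against Nakayama. *)
have gm : (g <= m)%N.
  rewrite -yg -xm leqNgt; apply/negP => lt.
  have [v] := nakayama_neq0 nA lA nM xmA M0; apply.
  by apply: koszul_acyclic0; apply: koszul_acyclic_regular ry xy _.
have [|N [p [theta [ps pE shift thetaB thetaI]]]] := koszul_rigidity (k := m - g) ry xy.
  by rewrite yg xm subnK.
have [phi [phi_inj phiI]] := koszul_homology_embed thetaB.
have nN : noeth N := noeth_surj ps nM.
have phiE v : (exists q, phi q = v) <-> forall a, a \in x -> a *: v = 0.
  by rewrite phiI thetaI.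
(* Otherwise some [a] in [I] is a nonzerodivisor on [N], and [rcons y a] is regular: its entries lie
   in [mA], so Nakayama supplies properness. *)
have [v v0 xv] : exists2 v : N, v <> 0 & forall a, a \in x -> a *: v = 0.
  apply: contrapT => nv.
  have [v xv|a /xI aI na] := nonzerodivisor_exists nA nN (lspan_submod (V := A^o) x).
    apply: contrapT => v0; apply: nv; exists v => // a ax.
    by apply: xv; apply: lspan_mem.
  apply: (ymax a aI); split.
    apply: weakly_regular_rcons ry _ => w; rewrite -!pE linearZ; exact: na.
  apply: (nakayama_neq0 nA lA nM) M0 => b; rewrite mem_rcons inE.
  by case/predU1P => [-> | /yI]; apply: Im.
have H0 : exists q : koszul_homology M x (m - g), q <> 0.
  have [q qv] := (phiE v).2 xv; exists q => q0; apply: v0.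
  by rewrite -qv q0 linear0.
have zN r : has_proj_resolution M r ->
    forall i, (r + g < i)%N -> koszul_acyclic z N i.
  by move=> hr; rewrite -yg; apply: shift; apply: koszul_acyclic_projdim hr.
split=> -[r [/zN hr _] rd].
  by apply: (annihilator_depth_ge1 nA lA phi_inj nN H0 zm); apply: hr; lia.
(* The integer bound forces d >= 2, so [d.-1] is a true predecessor. *)
have dE : size z = d.-1.+1 by lia.
by apply: (annihilator_depth_ge2 nA lA phi_inj nN phiE H0 zm _ dE); apply: hr; lia.
Qed.
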